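(* Let $k$ be a positive integer and let $H$ be a $C_{2k+1}$-decomposable graph. Then for every $\eta>0$ there exist $\rho=\rho(\eta,H)>0$ and $n_0$ such that for every $d$ and every $(\rho,d)$-dense graph $G$ with $|V(G)|\ge n_0$, \[ t_H(G)\ge d^{|E(H)|}-\eta. \]
   Context: All graphs are finite and simple; $C_{m}$ is the cycle of length $m$. For graphs $H,G$, $\mathrm{Hom}(H,G)$ is the set of graph homomorphisms from $H$ to $G$, and $t_H(G)=|\mathrm{Hom}(H,G)|/|V(G)|^{|V(H)|}$. A graph $G$ is $(\rho,d)$-dense if every $X\subseteq V(G)$ with $|X|\ge\rho|V(G)|$ spans at least $\frac d2|X|^2$ edges. A tree decomposition of $H$ is a pair $(\mathcal F,\mathcal T)$, $\mathcal F$ a family of subsets of $V(H)$ and $\mathcal T$ a tree on vertex set $\mathcal F$, such that (1) $\bigcup_{X\in\mathcal F}X=V(H)$; (2) every edge of $H$ lies in some $X\in\mathcal F$; (3) $X\cap Y\subseteq Z$ whenever $Z$ lies on the $\mathcal T$-path from $X$ to $Y$. For a graph $J$, a $J$-decomposition of $H$ is a tree decomposition $(\mathcal F,\mathcal T)$ such that each $H[X]$, $X\in\mathcal F$, is isomorphic to $J$, and for every pair $X,Y$ adjacent in $\mathcal T$ there is an isomorphism between $H[X]$ and $H[Y]$ fixing $X\cap Y$ pointwise. $H$ is $J$-decomposable if it has a $J$-decomposition.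
   Formalization: The density parameter d is assumed to satisfy d ≥ 0; for negative d every graph is (ρ,d)-dense and the claim fails when |E(H)| is even (e.g. two triangles sharing a vertex, d = −1, G edgeless). *)

(* Defs.v *)
From HB Require Import structures.
From mathcomp Require Import all_boot all_order all_algebra.
From mathcomp Require Import reals.

Set Implicit Arguments.
Unset Strict Implicit.
Unset Printing Implicit Defensive.

Import Order.TTheory GRing.Theory Num.Theory.

Local Open Scope ring_scope.

Record sgraph := SGraph {
  vertex :> finType;
  adj : rel vertex;
  adj_sym : symmetric adj;
  adj_irrefl : irreflexive adj }.

Definition edges (G : sgraph) : {set {set G}} :=
  [set [set p.1; p.2] | p : G * G & adj p.1 p.2].

Definition edges_in (G : sgraph) (X : {set G}) : {set {set G}} :=
  [set e in edges G | e \subset X].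

Section Induced.
Variables (G : sgraph) (X : {set G}).

Definition induced_adj : rel {x : G | x \in X} :=
  fun u v => adj (val u) (val v).

Lemma induced_sym : symmetric induced_adj.
Proof. by move=> u v; apply: adj_sym. Qed.

Lemma induced_irrefl : irreflexive induced_adj.
Proof. by move=> u; apply: adj_irrefl. Qed.

Definition induced : sgraph := SGraph induced_sym induced_irrefl.
End Induced.

(* This is the cycle of length m for m >= 3 only; the clause i != j rules out
   a loop when m = 1. *)
Section CycleGraph.
Variable m : nat.

Definition cycle_adj : rel 'I_m :=
  fun i j => (i != j) && ((j == ordS i) || (i == ordS j)).

Lemma cycle_sym : symmetric cycle_adj.
Proof. by move=> i j; rewrite /cycle_adj eq_sym orbC. Qed.

Lemma cycle_irrefl : irreflexive cycle_adj.
Proof. by move=> i; rewrite /cycle_adj eqxx. Qed.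

Definition cycle_graph : sgraph := SGraph cycle_sym cycle_irrefl.
End CycleGraph.

Definition is_hom (H G : sgraph) (f : H -> G) : bool :=
  [forall x, forall y, adj x y ==> adj (f x) (f y)].

Definition Hom (H G : sgraph) : {set {ffun H -> G}} :=
  [set f : {ffun H -> G} | is_hom f].

Definition hom_density (R : realType) (H G : sgraph) : R :=
  #|Hom H G|%:R / #|G|%:R ^+ #|H|.

Definition is_iso (G1 G2 : sgraph) (f : G1 -> G2) : Prop :=
  bijective f /\ forall x y, adj (f x) (f y) = adj x y.

Definition isomorphic (G1 G2 : sgraph) : Prop :=
  exists f : G1 -> G2, is_iso f.

Definition locally_dense (R : realType) (rho d : R) (G : sgraph) : Prop :=
  forall X : {set G}, rho * #|G|%:R <= #|X|%:R ->
    d / 2%:R * #|X|%:R ^+ 2 <= #|edges_in X|%:R.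

Definition is_tree (T : sgraph) : Prop :=
  [/\ (0 < #|T|)%N,
      forall x y : T, connect (@adj T) x y
    & forall c : seq T, (2 < size c)%N -> ~~ (cycle (@adj T) c && uniq c)].

(* The tree lives on the bags themselves: its vertex type is the set F. *)
Record tree_decomposition (H : sgraph) := TreeDecomposition {
  bags : {set {set H}};
  tadj : rel {X : {set H} | X \in bags};
  tadj_sym : symmetric tadj;
  tadj_irrefl : irreflexive tadj;
  tadj_tree : is_tree (SGraph tadj_sym tadj_irrefl);
  bags_cover : \bigcup_(X in bags) X = [set: H];
  bags_edge : forall x y : H, adj x y ->
    exists2 X, X \in bags & (x \in X) && (y \in X);
  (* X :: p runs over the simple paths of the tree, from X to last X p. *)
  bags_path : forall (X : {X : {set H} | X \in bags}) p,
    path tadj X p -> uniq (X :: p) ->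
    forall Z, Z \in X :: p -> val X :&: val (last X p) \subset val Z }.

Definition is_J_decomposition (J H : sgraph) (D : tree_decomposition H) : Prop :=
  (forall X, X \in bags D -> isomorphic (induced X) J) /\
  (forall X Y : {X : {set H} | X \in bags D}, tadj X Y ->
     exists f : induced (val X) -> induced (val Y),
       is_iso f /\ forall x, val x \in val Y -> val (f x) = val x).

Definition decomposable (J H : sgraph) : Prop :=
  exists D : tree_decomposition H, is_J_decomposition J D.

(* Main.v *)
Require Import Defs.
From HB Require Import structures.
From mathcomp Require Import all_boot all_order all_algebra.
From mathcomp Require Import reals.
From mathcomp Require Import exp.
From mathcomp Require Import ring lra zify.

Set Implicit Arguments.
Unset Strict Implicit.
Unset Printing Implicit Defensive.

Import Order.TTheory GRing.Theory Num.Theory.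

Local Open Scope ring_scope.

(* Write m = 2k+1 and let t, t_S be the homomorphism densities of C_m and of
   its induced subgraph on S. List the bags X_0, X_1, ..., X_r so that each X_i
   meets the union of its predecessors inside a single earlier bag, in S_i say.
   Gluing uniform random homomorphisms of the bags conditionally independently
   along the S_i gives a random homomorphism from H, and an entropy computation
   yields t_H >= t * prod_i (t / t_(S_i)).
   Let w_j be the density of walks of length j. A quadratic form version of
   local density, applied to the k-step walks from a vertex, gives
   t >= d * w_(2k) up to a small error. As S_i is a proper subset of the cycle,
   it spans a linear forest with some e_i edges; log-convexity of the even w_j
   gives t_(S_i) ^ (2k) <= w_(2k) ^ e_i, and w_(2k) >= d ^ (2k). Hence
   t / t_(S_i) >= d ^ (m - e_i) up to a factor close to 1, while
   m + sum_i (m - e_i) <= |E(H)|. *)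

(** * Averages over finite types *)

Section Mean.
Variable R : realFieldType.
Implicit Types I J : finType.

Definition mean I (F : I -> R) : R := (\sum_i F i) / #|I|%:R.

Lemma eq_mean I (F F' : I -> R) : F =1 F' -> mean F = mean F'.
Proof. by move=> eqF; rewrite /mean (eq_bigr F'). Qed.

Lemma meanD I (F F' : I -> R) : mean (fun i => F i + F' i) = mean F + mean F'.
Proof. by rewrite /mean big_split mulrDl. Qed.

Lemma meanZ I c (F : I -> R) : mean (fun i => c * F i) = c * mean F.
Proof. by rewrite /mean -mulr_sumr mulrA. Qed.

Lemma meanZr I c (F : I -> R) : mean (fun i => F i * c) = mean F * c.
Proof. by rewrite /mean -mulr_suml mulrAC. Qed.

Lemma mean_cst I (i0 : I) c : mean (fun _ : I => c : R) = c.
Proof.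
rewrite /mean sumr_const -[c *+ _]mulr_natr mulfK// pnatr_eq0 -lt0n.
by apply/card_gt0P; exists i0.
Qed.

Lemma ler_mean I (F F' : I -> R) :
  (forall i, F i <= F' i) -> mean F <= mean F'.
Proof. by move=> leF; rewrite ler_wpM2r ?invr_ge0 ?ler0n// ler_sum. Qed.

Lemma mean_ge0 I (F : I -> R) : (forall i, 0 <= F i) -> 0 <= mean F.
Proof. by move=> F0; rewrite mulr_ge0 ?invr_ge0 ?ler0n// sumr_ge0. Qed.

Lemma mean_sum I K (r : seq K) (F : K -> I -> R) :
  mean (fun i => \sum_(j <- r) F j i) = \sum_(j <- r) mean (F j).
Proof. by rewrite /mean exchange_big mulr_suml. Qed.

Lemma mean_pair I J (F : I -> J -> R) :
  mean (fun i => mean (F i)) = mean (fun p : I * J => F p.1 p.2).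
Proof.
rewrite /mean -mulr_suml -(pair_bigA _ F) card_prod natrM invfM mulrA mulrAC.
by [].
Qed.

Lemma exchange_mean I J (F : I -> J -> R) :
  mean (fun i => mean (F i)) = mean (fun j => mean (F^~ j)).
Proof.
by rewrite /mean -mulr_suml exchange_big -mulr_suml mulrAC.
Qed.

Lemma reindex_mean I J (f : J -> I) (F : I -> R) :
  bijective f -> mean F = mean (F \o f).
Proof.
move=> bf; rewrite /mean (reindex f); last exact: onW_bij.
by rewrite (bij_eq_card bf).
Qed.

End Mean.

(** * Conditional expectation for a uniform random map *)

Section Coordinates.
Variables (R : realFieldType) (V T : finType).
Implicit Types (S A B : {set V}) (h : {ffun V -> T}) (F K : {ffun V -> T} -> R).

Definition mix S h h' : {ffun V -> T} :=
  [ffun x => if x \in S then h x else h' x].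

Definition depends_on S F := forall h h', {in S, h =1 h'} -> F h = F h'.

(** The conditional expectation of [F] given the restriction of a uniform map to [S]: the
    coordinates off [S] are resampled. It stays a function of the whole map so that all factors live
    on one space. *)
Definition cond S F h := mean (fun h' => F (mix S h h')).

Lemma depends_onS A B F : A \subset B -> depends_on A F -> depends_on B F.
Proof. by move=> /subsetP AB dF h h' e; apply: dF => x /AB; apply: e. Qed.

Lemma depends_onM S F K :
  depends_on S F -> depends_on S K -> depends_on S (fun h => F h * K h).
Proof. by move=> dF dK h h' e; rewrite (dF _ _ e) (dK _ _ e). Qed.

Lemma depends_onV S F : depends_on S F -> depends_on S (fun h => (F h)^-1).
Proof. by move=> dF h h' e; rewrite (dF _ _ e). Qed.

Lemma cond_depends_on S F : depends_on S (cond S F).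
Proof.
move=> h h' e; apply: eq_mean => h1; congr F; apply/ffunP => x.
by rewrite !ffunE; case: ifP => // /e.
Qed.

(** The tower property. [sw] exchanges the coordinates off [S] of two independent maps; this
    preserves the uniform measure on pairs and turns the resampled map back into [h]. *)
Lemma mean_cond S F K : depends_on S K ->
  mean (fun h => cond S F h * K h) = mean (fun h => F h * K h).
Proof.
move=> dK; pose sw (p : {ffun V -> T} * {ffun V -> T}) :=
  (mix S p.1 p.2, mix S p.2 p.1).
have sw_inv : involutive sw.
  by case=> h h'; congr pair; apply/ffunP => x; rewrite !ffunE; case: (x \in S).
transitivity (mean (fun h => mean (fun h' => F (mix S h h') * K h))).
  by apply: eq_mean => h; rewrite meanZr.
rewrite mean_pair (reindex_mean _ (inv_bij sw_inv)).
transitivity (mean (fun h => mean (fun _ : {ffun V -> T} => F h * K h))).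
  rewrite mean_pair; apply: eq_mean => -[h h'] /=; congr (F _ * _).
    by apply/ffunP => x; rewrite !ffunE; case: (x \in S).
  by apply: dK => x xS; rewrite ffunE xS.
by apply: eq_mean => h; rewrite (mean_cst h).
Qed.

Lemma cond_setI A B F : depends_on B F -> cond A F =1 cond (A :&: B) F.
Proof.
move=> dF h; apply: eq_mean => h'; apply: dF => x xB.
by rewrite !ffunE inE xB andbT.
Qed.

Lemma cond_ge0 S F h : (forall h, 0 <= F h) -> 0 <= cond S F h.
Proof. by move=> F0; apply: mean_ge0. Qed.

Lemma cond_gt0 S F h : (forall h, 0 <= F h) -> 0 < F h -> 0 < cond S F h.
Proof.
move=> F0 Fh; apply: mulr_gt0.
  rewrite (bigD1 h)//=; apply: ltr_pwDl; last by apply: sumr_ge0.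
  by rewrite (_ : mix S h h = h)//; apply/ffunP => x; rewrite ffunE if_same.
by rewrite invr_gt0 ltr0n; apply/card_gt0P; exists h.
Qed.

Lemma cond_neq0 S F h : cond S F h != 0 -> exists h', F (mix S h h') != 0.
Proof.
move=> nz; apply/existsP; apply: contraR nz; rewrite negb_exists => /forallP F0.
rewrite /cond /mean big1 ?mul0r// => h' _; apply/eqP.
by have := F0 h'; rewrite negbK.
Qed.

End Coordinates.

(** * Gluing parts conditionally independently, and the entropy bound *)

Section Gluing.
Variables (V : finType) (link : {set V} -> {set V} -> Prop).
Variable X0 : {set V}.
Implicit Types (X Y Z : {set V}) (l : seq ({set V} * {set V})).

Definition parts l := rcons (unzip1 l) X0.

(** The list runs backwards in time, newest pair first and [X0] below all of them, so that undoing
    the last gluing is structural. The second component of a pair is the part to which the first is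
    attached. *)
Inductive gluing : seq ({set V} * {set V}) -> Prop :=
| gluing_nil : gluing [::]
| gluing_cons X Y l : gluing l -> Y \in parts l ->
    X :&: \bigcup_(Z <- parts l) Z \subset Y -> link X Y ->
    gluing ((X, Y) :: l).

Lemma gluing_link l p : gluing l -> p \in l ->
  [/\ p.1 \in parts l, p.2 \in parts l & link p.1 p.2].
Proof.
elim=> {l} // X Y l gl IH Yl XUY lXY.
rewrite inE => /predU1P[->|/IH[]] /=; first by rewrite !inE eqxx Yl orbT.
by rewrite !inE => -> -> ?; rewrite !orbT.
Qed.

Variables (R : realType) (T : finType).
Variable ind : {set V} -> pred {ffun V -> T}.
Notation indr X := (fun h => (ind X h)%:R : R).
Hypothesis ind_depends : forall X, depends_on X (indr X).
Hypothesis indS : forall X Y h, X \subset Y -> ind Y h -> ind X h.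
Hypothesis link_cond : forall X Y, link X Y ->
  cond (X :&: Y) (indr X) =1 cond (X :&: Y) (indr Y).

Notation q p := (cond (p.1 :&: p.2) (indr p.1)).

(* Up to normalization, the density of the random map obtained by choosing a
   uniform homomorphism on X0 and then extending it part by part, each time
   conditionally independently of the past. *)
Fixpoint weight l h : R :=
  if l is p :: l' then weight l' h * (ind p.1 h)%:R / q p h
  else (ind X0 h)%:R.

Lemma sub_parts l Z : Z \in parts l -> Z \subset \bigcup_(Z <- parts l) Z.
Proof. by move=> Zl; rewrite (big_rem _ Zl) subsetUl. Qed.

Lemma setI_between X Y (U : {set V}) :
  X :&: U \subset Y -> Y \subset U -> U :&: X = X :&: Y.
Proof.
move=> /subsetP XUY /subsetP YU; apply/setP => x; rewrite !inE andbC.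
apply: andb_id2l => xX; apply/idP/idP => [xU|]; last exact: YU.
by apply: XUY; rewrite inE xX.
Qed.

Lemma weight_ge0 l h : 0 <= weight l h.
Proof.
elim: l => [|p l IH] /=; first exact: ler0n.
apply: divr_ge0; first exact: mulr_ge0 IH (ler0n _ _).
by apply: cond_ge0 => h'; apply: ler0n.
Qed.

Lemma weight_depends_on l : depends_on (\bigcup_(Z <- parts l) Z) (weight l).
Proof.
elim: l => [|p l IH]; first by rewrite /parts /= big_seq1; apply: ind_depends.
rewrite /parts /= big_cons; apply: depends_onM.
  apply: depends_onM; first exact: depends_onS (subsetUr _ _) IH.
  exact: depends_onS (subsetUl _ _) (@ind_depends p.1).
apply/depends_onV/(depends_onS _ (@cond_depends_on _ _ _ _ _)).
exact: subset_trans (subsetIl _ _) (subsetUl _ _).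
Qed.

Lemma weight_neq0 l h : weight l h != 0 -> {in parts l, forall Z, ind Z h}.
Proof.
elim: l => [|p l IH] /=.
  by rewrite pnatr_eq0 eqb0 negbK => X0h Z; rewrite inE => /eqP->.
rewrite !mulf_eq0 !negb_or => /andP[/andP[/IH wh ph] _] Z.
rewrite inE => /predU1P[->|/wh//].
by move: ph; rewrite pnatr_eq0 eqb0 negbK.
Qed.

Lemma indr_cond X S h : ind X h -> 0 < cond S (indr X) h.
Proof.
by move=> Xh; apply: cond_gt0 => [h'|]; rewrite ?Xh ?ltr01.
Qed.

(** When all indicators are 1, [h] itself witnesses that each conditional mean is positive, so no
    division is degenerate and the weight is a product of reciprocals. *)
Lemma weight_prod l h : {in parts l, forall Z, ind Z h} ->
  (forall p, p \in l -> 0 < q p h) /\ weight l h * \prod_(p <- l) q p h = 1.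
Proof.
elim: l => [|p l IH] indh /=.
  by split=> //; rewrite big_nil mulr1 indh ?inE.
have q0 : 0 < q p h by apply/indr_cond/indh; rewrite inE eqxx.
have [|ql wl] := IH; first by move=> Z Zl; apply: indh; rewrite inE Zl orbT.
split=> [p'|]; first by rewrite inE => /predU1P[->|/ql].
by rewrite big_cons indh ?inE ?eqxx// mulr1 mulrA divfK// lt0r_neq0.
Qed.

(** Gluing a new part does not disturb the law on the earlier ones: averaging over the new
    coordinates replaces [ind X] by its conditional mean, which is the denominator. That denominator
    is positive on the support of the old weight, since [ind Y] holds there and [link_cond] lets [Y]
    stand in for [X]. *)
Lemma mean_weight_cons X Y l g : gluing ((X, Y) :: l) ->
  depends_on (\bigcup_(Z <- parts l) Z) g ->
  mean (fun h => weight ((X, Y) :: l) h * g h) = mean (fun h => weight l h * g h).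
Proof.
move=> gl dg; inversion gl as [|X' Y' l' gl' Yl XUY lXY]; subst X' Y' l'.
set U := \bigcup_(_ <- _) _ in dg XUY; pose S := X :&: Y.
have SU : U :&: X = S.
  by apply: setI_between XUY (sub_parts Yl).
have dq : depends_on U (cond S (indr X)).
  by apply: depends_onS (@cond_depends_on _ _ _ _ _); rewrite -SU subsetIl.
transitivity (mean (fun h => (ind X h)%:R * (weight l h * g h / q (X, Y) h))).
  by apply: eq_mean => h /=; ring.
rewrite -(@mean_cond _ _ _ U); last first.
  apply: depends_onM; first by apply: depends_onM => //; apply: weight_depends_on.
  exact: depends_onV.
apply: eq_mean => h; rewrite (cond_setI _ (@ind_depends X)) SU.
have [->|wn0] := eqVneq (weight l h) 0; first by rewrite !mul0r mulr0.
suff q0 : q (X, Y) h != 0 by rewrite mulrC mulfVK.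
rewrite /= link_cond//; apply/lt0r_neq0/indr_cond.
exact: weight_neq0 wn0 _ Yl.
Qed.

(** Each part keeps the marginal of a uniform homomorphism. For the newest part [X], conditioning on
    the past only sees [S]; the law on [S] is inherited from [Y], and by [link_cond] its density
    cancels the denominator. *)
Lemma mean_weight l Z g : gluing l -> Z \in parts l -> depends_on Z g ->
  mean (fun h => weight l h * g h) = mean (fun h => (ind Z h)%:R * g h).
Proof.
move=> gl; elim: gl Z g => {l} [|X Y l gl IH Yl XUY lXY] Z g.
  by rewrite inE => /eqP->.
have gl' : gluing ((X, Y) :: l) by constructor.
rewrite inE => /predU1P[->|Zl] dg; last first.
  by rewrite mean_weight_cons//; [exact: IH | exact: depends_onS (sub_parts Zl) dg].
set U := \bigcup_(_ <- _) _ in XUY; pose S := X :&: Y.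
have SU : U :&: X = S.
  by apply: setI_between XUY (sub_parts Yl).
have SsubU : S \subset U by rewrite -SU subsetIl.
have dq (A : {set V}) : S \subset A -> depends_on A (cond S (indr X)).
  by move=> SA; exact: depends_onS SA (@cond_depends_on _ _ _ _ _).
pose f h := (ind X h)%:R * g h; have df : depends_on X f by apply: depends_onM.
transitivity (mean (fun h => f h * (weight l h / q (X, Y) h))).
  by apply: eq_mean => h /=; rewrite /f; ring.
rewrite -(@mean_cond _ _ _ U); last first.
  by apply: depends_onM; [apply: weight_depends_on | apply/depends_onV/dq].
transitivity (mean (fun h => weight l h * (cond S f h / q (X, Y) h))).
  by apply: eq_mean => h; rewrite (cond_setI _ df) SU; ring.
have SY : S \subset Y by exact: subsetIr.
rewrite (IH Y)//; last first.
  apply: depends_onM; last exact/depends_onV/dq.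
  by exact: depends_onS SY (@cond_depends_on _ _ _ _ _).
rewrite -(@mean_cond _ _ _ S); last first.
  by apply: depends_onM; [apply: cond_depends_on | apply/depends_onV/dq].
(* Since division by zero yields 0, the cancellation leaves the indicator of a nonzero denominator.
   It disappears at the end because [ind X h] makes the denominator positive. *)
transitivity (mean (fun h => cond S f h * (cond S (indr X) h != 0)%:R)).
  apply: eq_mean => h; rewrite -link_cond//= mulrCA; congr (_ * _).
  have [->|q0] /= := eqVneq (cond S (indr X) h) 0; first by rewrite mul0r.
  by rewrite mulfV.
rewrite mean_cond; last first.
  by move=> h h' e; rewrite (cond_depends_on _ e).
apply: eq_mean => h; rewrite /f.
case Xh: (ind X h); last by rewrite !mul0r.
by rewrite lt0r_neq0 ?mulr1//; apply: indr_cond.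
Qed.

(* Tangent line of the logarithm: this replaces Jensen's inequality for the
   entropy. *)
Lemma prod_inv_ge (K : eqType) (r : seq K) (z : K -> R) :
  {in r, forall i, 0 < z i} ->
  1 + \sum_(i <- r) (1 - z i) <= \prod_(i <- r) (z i)^-1.
Proof.
move=> z0; apply: (le_trans (expR_ge1Dx _)); rewrite expR_sum.
rewrite big_seq [leRHS]big_seq; apply: ler_prod => i ir.
rewrite expR_ge0/= -[1 - z i]opprB expRN lef_pV2 ?posrE ?expR_gt0 ?z0//.
by have := expR_ge1Dx (z i - 1); rewrite addrC subrK.
Qed.

(** On the support of the weight, the indicator equals the weight times [C] times the product of the
    inverses of the [z p]. The tangent line bound makes this product linear in the [z p]; as the
    weight has mean [t], it remains to see that each [z p] has weighted mean at most [t]. *)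
Lemma gluing_bound l t : gluing l -> 0 < t ->
  {in parts l, forall Z, mean (indr Z) = t} ->
  t * \prod_(p <- l) (t / mean (indr (p.1 :&: p.2))) <=
  mean (fun h => (all (fun Z => ind Z h) (parts l))%:R).
Proof.
move=> gl t0 meant; pose s (p : {set V} * {set V}) := mean (indr (p.1 :&: p.2)).
have s0 p : p \in l -> 0 < s p.
  move=> /(gluing_link gl)[/meant tp _ _]; apply: lt_le_trans t0 _; rewrite -tp.
  apply: ler_mean => h; rewrite ler_nat; case ph: (ind p.1 h) => //.
  by rewrite (indS (subsetIl _ _) ph).
(* The likelihood ratio on the overlap between the uniform homomorphism, of density 1/s, and the law
   inherited from a part, of density q/t. *)
pose z p h := t / (s p * q p h).
pose C := \prod_(p <- l) (t / s p).
have C0 : 0 <= C.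
  by rewrite /C big_seq; apply: prodr_ge0 => p /s0 sp; rewrite divr_ge0// ltW.
apply: (@le_trans _ _
  (mean (fun h => weight l h * (C * (1 + \sum_(p <- l) (1 - z p h)))))); last first.
  apply: ler_mean => h.
  have [->|wn0] := eqVneq (weight l h) 0; first by rewrite mul0r ler0n.
  have indh := weight_neq0 wn0.
  have -> : all (fun Z => ind Z h) (parts l) by apply/allP.
  have [q0 w_prod] := weight_prod indh.
  have z0 : {in l, forall p, 0 < z p h}.
    move=> p pl; apply: divr_gt0 => //.
    by apply: mulr_gt0; [apply: s0 | apply: q0].
  have -> : 1%:R = weight l h * (C * \prod_(p <- l) (z p h)^-1).
    rewrite -[LHS]w_prod /C -big_split/=; congr (_ * _).
    rewrite big_seq [RHS]big_seq; apply: eq_bigr => p pl.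
    rewrite /z; move: (cond _ _ h) (q0 p pl) (s p) (s0 p pl) => a a0 b b0.
    by field; rewrite !lt0r_neq0.
  by rewrite ler_wpM2l ?weight_ge0// ler_wpM2l// prod_inv_ge.
have X0l : X0 \in parts l by rewrite mem_rcons inE eqxx.
have meanw : mean (weight l) = t.
  rewrite -(meant _ X0l).
  have := mean_weight (g := fun=> 1) gl X0l; rewrite !meanZr !mulr1.
  exact.
rewrite (eq_mean (F' := fun h => C * (weight l h +
    \sum_(p <- l) (weight l h - weight l h * z p h)))); last first.
  move=> h; rewrite mulrCA mulrDr mulr1 mulr_sumr; congr (_ * (_ + _)).
  by apply: eq_bigr => p _; rewrite mulrBr mulr1.
rewrite meanZ [leLHS]mulrC ler_wpM2l// meanD meanw lerDl mean_sum.
rewrite big_seq; apply: sumr_ge0 => p pl.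
have [_ Yl lXY] := gluing_link gl pl; set S := p.1 :&: p.2.
have dz Z : S \subset Z -> depends_on Z (z p).
  move=> SZ h h' e; rewrite /z.
  by rewrite (depends_onS SZ (@cond_depends_on _ _ _ S (indr p.1)) e).
rewrite (eq_mean (F' := fun h => weight l h + (-1) * (weight l h * z p h))); last first.
  by move=> h; rewrite mulN1r.
rewrite meanD meanZ mulN1r meanw subr_ge0.
(* Passing to the marginal on the attaching part and conditioning on [S] produces the factor [q]
   that cancels the one in [z]. *)
rewrite (mean_weight gl Yl); last by apply: dz; apply: subsetIr.
rewrite -(@mean_cond _ _ _ S); last exact: dz.
have sp := s0 p pl.
have -> : t = t / s p * mean (indr S) by rewrite divfK// lt0r_neq0.
rewrite -meanZ; apply: ler_mean => h.
rewrite /z -link_cond// -/S.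
(* If [q] vanishes the left side is 0. Otherwise some resampled map satisfies [ind p.1], and it
   agrees with [h] on [S], whence [ind S h]. *)
have [->|qn0] := eqVneq (cond S (indr p.1) h) 0.
  by rewrite mul0r mulr_ge0// divr_ge0// ltW.
rewrite [leLHS](_ : _ = t / s p); last by field; rewrite qn0 lt0r_neq0.
have [h' ] := cond_neq0 qn0; rewrite pnatr_eq0 eqb0 negbK => indh'.
have -> : ind S h.
  have dS : (ind S (mix S h h'))%:R = (ind S h)%:R :> R.
    by apply: ind_depends => x xS; rewrite ffunE xS.
  have := indS (subsetIl p.1 p.2) indh'; rewrite -/S => iS.
  by move: dS; rewrite iS; case: (ind S h) => // /eqP; rewrite oner_eq0.
by rewrite mulr1.
Qed.

End Gluing.

(** * From tree decompositions to gluing sequences *)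

Section Linked.
Variable H : sgraph.
Implicit Types X Y Z : {set H}.

(* The isomorphism of the bags is extended to an involution of all vertices
   that exchanges X and Y. *)
Definition linked X Y : Prop := X <> Y /\
  exists s : H -> H,
    [/\ involutive s, {in X :&: Y, s =1 id}, forall x, (s x \in Y) = (x \in X)
      & {in X &, forall x y, adj (s x) (s y) = adj x y}].

(** [phi] and [psi] extend [f] and its inverse by the identity. If [phi x] lies in both bags then
    [psi] fixes it, so [x = phi x]; hence vertices outside the overlap leave their bag, and [phi] on
    [X], [psi] on the rest of [Y] fit together into an involution. *)
Lemma iso_linked X Y (f : induced X -> induced Y) : X <> Y -> is_iso f ->
  (forall x, val x \in Y -> val (f x) = val x) -> linked X Y.
Proof.
move=> XY [[g fK gK] fadj] ffix; split=> //.
pose phi x := if insub x is Some u then val (f u) else x.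
pose psi x := if insub x is Some u then val (g u) else x.
have phiE x (xX : x \in X) : phi x = val (f (Sub x xX)) by rewrite /phi insubT.
have psiE x (xY : x \in Y) : psi x = val (g (Sub x xY)) by rewrite /psi insubT.
have phiY x : x \in X -> phi x \in Y by move=> xX; rewrite phiE; apply: valP.
have psiX x : x \in Y -> psi x \in X by move=> xY; rewrite psiE; apply: valP.
have phiK : {in X, cancel phi psi}.
  move=> x xX; have yY := phiY _ xX; rewrite (psiE _ yY).
  rewrite (_ : Sub _ _ = f (Sub x xX)) ?fK//.
  by apply: val_inj; rewrite SubK phiE.
have psiK : {in Y, cancel psi phi}.
  move=> x xY; have yX := psiX _ xY; rewrite (phiE _ yX).
  rewrite (_ : Sub _ _ = g (Sub x xY)) ?gK//.
  by apply: val_inj; rewrite SubK psiE.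
have phi_fix x : x \in X -> x \in Y -> phi x = x.
  by move=> xX xY; rewrite phiE ffix.
have psi_fix x : x \in X -> x \in Y -> psi x = x.
  by move=> xX xY; rewrite -{1}(phi_fix x xX xY) phiK.
have phiX x : x \in X -> (phi x \in X) = (x \in Y).
  move=> xX; apply/idP/idP => [pX|xY]; last by rewrite phi_fix.
  have pY := phiY _ xX; have := psi_fix _ pX pY; rewrite phiK// => ->.
  exact: phiY.
have psiY x : x \in Y -> (psi x \in Y) = (x \in X).
  move=> xY; apply/idP/idP => [pY|xX]; last by rewrite psi_fix.
  have pX := psiX _ xY; have := phi_fix _ pX pY; rewrite psiK// => ->.
  exact: psiX.
exists (fun x => if x \in X then phi x else if x \in Y then psi x else x); split.
- move=> x; have [xX|/negbTE xX] := boolP (x \in X).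
    rewrite phiX// phiY// phiK//.
    by have [xY|] := boolP (x \in Y); rewrite ?(phi_fix x).
  have [xY|/negbTE xY] := boolP (x \in Y); last by rewrite xX xY.
  by rewrite psiX// psiK.
- by move=> x /setIP[xX xY]; rewrite xX phi_fix.
- move=> x; case: ifP => [xX|xX]; first by rewrite phiY.
  have [xY|/negbTE//] := boolP (x \in Y); by rewrite psiY.
- move=> x y xX yX; rewrite xX yX !phiE.
  by have := fadj (Sub x xX) (Sub y yX).
Qed.

End Linked.

(** The bags are listed by growing a connected set [A] of tree nodes from a root, each time across a
    tree edge leaving [A]. The induction is on the number of nodes still missing. *)
Lemma decomposable_gluing (J H : sgraph) : decomposable J H ->
  exists X0 l, [/\ gluing (@linked H) X0 l,
    {in parts X0 l, forall Z, isomorphic (induced Z) J}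
  & forall x y : H, adj x y ->
      exists2 Z, Z \in parts X0 l & (x \in Z) && (y \in Z)].
Proof.
case=> D [isoD adhD]; pose B := {X : {set H} | X \in bags D}.
have [] := tadj_tree D; rewrite /= => /card_gt0P[root _] conn _.
pose restr (A : {set B}) := [rel a b : B | [&& tadj a b, a \in A & b \in A]].
suff [l [gl partsl]] : exists l, gluing (@linked H) (val root) l /\
    parts (val root) l =i bags D.
  exists (val root), l; split=> // [Z|x y xy]; first by rewrite partsl => /isoD.
  by have [Z Zb xyZ] := bags_edge D xy; exists Z; rewrite ?partsl.
pose inv l (A : {set B}) := [/\ gluing (@linked H) (val root) l,
  parts (val root) l =i [set val Z | Z in A]
  & forall Z, Z \in A -> connect (restr A) root Z].
suff {isoD} : forall n l A, inv l A -> root \in A -> (#|~: A| <= n)%N ->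
    exists l, gluing (@linked H) (val root) l /\ parts (val root) l =i bags D.
  move=> /(_ _ [::] [set root] _ _ (leqnn _)); apply; last by rewrite inE.
  split; first exact: gluing_nil.
    by move=> X; rewrite imset_set1 !inE.
  by move=> Z /set1P->.
elim=> [|n IH] l A [gl partsl connA] rA cardA.
  exists l; split=> // X; rewrite partsl; apply/imsetP/idP => [[Z _ ->]|Xb].
    exact: valP.
  exists (Sub X Xb : B); last by rewrite SubK.
  by move: cardA; rewrite leqn0 cards_eq0 => /eqP/setP/(_ (Sub X Xb)); rewrite !inE => /negbFE.
have [|/existsPn nocross] := boolP [exists p : B * B,
    [&& tadj p.1 p.2, p.1 \in A & p.2 \notin A]]; last first.
  (* With no edge leaving [A], connectedness of the tree makes [A] everything. *)
  have cl : closed (@tadj _ D) (mem A).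
    move=> x y xy; apply/idP/idP => [xA|yA].
      by have := nocross (x, y); rewrite /= xy xA negbK.
    by have := nocross (y, x); rewrite /= tadj_sym xy yA negbK.
  apply: (IH l A); [by split | by [] |].
  rewrite (_ : ~: A = set0) ?cards0//; apply/setP => Z; rewrite !inE.
  by rewrite -[Z \in A](closed_connect cl (conn root Z)) rA.
case/existsP=> -[Y X] /and3P[/= YX YA XA].
apply: (IH ((val X, val Y) :: l) (X |: A)).
- split.
  + constructor=> //; first by rewrite partsl imset_f.
      apply/subsetP => v /setIP[vX]; rewrite bigcup_seq => /bigcupP[Z'].
      rewrite partsl => /imsetP[Z ZA ->{Z'}] vZ.
      have rsym : connect_sym (restr A).
        apply: sym_connect_sym => a b; rewrite /= tadj_sym.
        by rewrite [(a \in A) && _]andbC.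
      (* A simple path from [Y] to [Z] inside [A], prefixed by [X] outside [A], is a simple tree
         path through [Y]; the path axiom then puts the common vertex [v] in [Y]. *)
      have : connect (restr A) Y Z.
        by apply: connect_trans (connA _ ZA); rewrite rsym; apply: connA.
      case/connectP => p pp; case/shortenP: pp => p' pp' up' _ eZ.
      have p'A : {subset Y :: p' <= A}.
        move=> W; rewrite inE => /predU1P[->//|Wp'].
        move: pp' Wp'; elim: (p') (Y) {up' eZ} => //= a q IHq b.
        case/andP=> /and3P[_ _ aA] qq; rewrite inE => /predU1P[->//|Wq].
        exact: IHq qq Wq.
      have ptadj : path (@tadj _ D) X (Y :: p').
        rewrite /= tadj_sym YX/=; apply: sub_path pp' => a b /=.
        by case/and3P.
      have uq : uniq (X :: Y :: p').
        rewrite cons_uniq up' andbT; apply/negP => /p'A.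
        by rewrite (negbTE XA).
      have Yin : Y \in [:: X, Y & p'] by rewrite !inE eqxx orbT.
      have /subsetP := bags_path ptadj uq Yin.
      by apply; rewrite inE vX /= -eZ.
    have [f [fiso ffix]] := adhD X Y (etrans (tadj_sym _ _) YX).
    apply: iso_linked fiso ffix => /val_inj eXY.
    by move: XA; rewrite eXY YA.
  + by move=> W; rewrite /parts /= imsetU1 !inE -partsl.
  + have sub : subrel (restr A) (restr (X |: A)).
      by move=> a b /= /and3P[-> aA bA]; rewrite !inE aA bA !orbT.
    have csub a b : connect (restr A) a b -> connect (restr (X |: A)) a b.
      by apply: connect_sub => u v uv; apply/connect1/sub.
    move=> Z; rewrite inE => /orP[/set1P->|/connA/csub//].
    apply: connect_trans (csub _ _ (connA _ YA)) (connect1 _).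
    by rewrite /= YX !inE YA eqxx orbT.
- by rewrite inE rA orbT.
- rewrite setCU -ltnS; apply: leq_trans cardA; apply: proper_card.
  apply/properP; split; first exact: subsetIr.
  by exists X; rewrite !inE ?eqxx.
Qed.

(** * Homomorphisms from induced subgraphs *)

Section HomOn.
Variables (R : realType) (H G : sgraph).
Implicit Types (X Y S : {set H}) (h : {ffun H -> G}).

(** Homomorphisms of the subgraph induced on [X], encoded as total maps with free values off [X]:
    the mean of the indicator is then the homomorphism density of that subgraph. *)
Definition hom_on X : pred {ffun H -> G} := fun h =>
  [forall x, forall y, [&& x \in X, y \in X & adj x y] ==> adj (h x) (h y)].

Lemma hom_onP X h :
  reflect {in X &, forall x y, adj x y -> adj (h x) (h y)} (hom_on X h).
Proof.
apply: (iffP forallP) => [hX x y xX yX xy | hX x].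
  by have /forallP/(_ y)/implyP := hX x; apply; rewrite xX yX.
by apply/forallP => y; apply/implyP => /and3P[]; apply: hX.
Qed.

Lemma hom_on_depends X : depends_on X (fun h => (hom_on X h)%:R : R).
Proof.
move=> h h' e; congr (nat_of_bool _)%:R.
by apply/hom_onP/hom_onP => hX x y xX yX /(hX x y xX yX); rewrite !e.
Qed.

Lemma hom_onS X Y h : X \subset Y -> hom_on Y h -> hom_on X h.
Proof.
by move=> /subsetP XY /hom_onP hY; apply/hom_onP => x y /XY ? /XY; apply: hY.
Qed.

(** Precomposition with the involution [s] preserves the uniform measure, keeps the values on the
    overlap and exchanges homomorphisms on [X] with those on [Y]. *)
Lemma linked_cond X Y : linked X Y ->
  cond (X :&: Y) (fun h => (hom_on X h)%:R : R) =1
  cond (X :&: Y) (fun h => (hom_on Y h)%:R : R).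
Proof.
case=> _ [s [sK sfix sXY sadj]] h; set S := X :&: Y.
pose cs h : {ffun H -> G} := [ffun x => h (s x)].
have csK : involutive cs by move=> h1; apply/ffunP => x; rewrite !ffunE sK.
rewrite [RHS]/cond (reindex_mean _ (inv_bij csK)); apply: eq_mean => h1 /=.
have sS x : (s x \in S) = (x \in S).
  apply/idP/idP => xS; last by rewrite sfix.
  by rewrite -(sK x) (sfix _ xS).
have -> : mix S h (cs h1) = cs (mix S h h1).
  apply/ffunP => x; rewrite !ffunE sS; case: ifP => // xS.
  by rewrite sfix.
have csE g x : cs g x = g (s x) by rewrite ffunE.
congr (nat_of_bool _)%:R; apply/hom_onP/hom_onP => hX x y xX yX xy.
  have sY z : z \in Y -> s z \in X by move=> zY; rewrite -sXY sK.
  by rewrite !csE; apply: hX; rewrite ?sY// -sadj ?sY// !sK.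
by have := hX (s x) (s y); rewrite !sXY sadj// !csE !sK; apply.
Qed.

Lemma mean_hom_density :
  hom_density R H G = mean (fun h : {ffun H -> G} => (is_hom h)%:R).
Proof.
rewrite /hom_density /mean card_ffun natrX; congr (_ / _).
rewrite -sum1_card natr_sum big_mkcond; apply: eq_bigr => h _.
by rewrite inE; case: is_hom.
Qed.

End HomOn.

(** * Local density for weighted vertex sets *)

Lemma card_edges_in (G : sgraph) (X : {set G}) :
  (2 * #|edges_in X| <= \sum_(x in X) \sum_(y in X) adj x y)%N.
Proof.
pose D := [set p : G * G | [&& p.1 \in X, p.2 \in X & adj p.1 p.2]].
pose f (p : G * G) := [set p.1; p.2].
have -> : edges_in X = f @: D.
  apply/setP => e; rewrite inE; apply/andP/imsetP => [[/imsetP[p ap ->]]|[p]].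
    rewrite subUset !sub1set => /andP[p1 p2]; exists p => //.
    by rewrite inE p1 p2; move: ap; rewrite inE.
  rewrite inE => /and3P[p1 p2 ap] ->; split.
    by apply/imsetP; exists p; rewrite ?inE.
  by rewrite subUset !sub1set p1.
have -> : (\sum_(x in X) \sum_(y in X) adj x y = #|D|)%N.
  rewrite pair_big /= -sum1_card big_mkcond [RHS]big_mkcond.
  apply: eq_bigr => p _; rewrite inE.
  by case: (p.1 \in X); case: (p.2 \in X); case: adj.
(* An edge arises from both orderings of its ends, which differ as there are no loops, so every
   fibre of [f] has at least two elements. *)
rewrite -[#|D|]sum1_card (partition_big_imset f)/= mulnC -sum_nat_const.
apply: leq_sum => e /imsetP[p pD ->].
move: pD; rewrite inE => /and3P[p1 p2 ap].
rewrite sum1dep_card -[2%N]/(true.+1).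
have pneq : p != (p.2, p.1).
  case: p ap {p1 p2} => x y /= ap; rewrite xpair_eqE; apply/negP => /andP[/eqP e1 _].
  by move: ap; rewrite e1 adj_irrefl.
rewrite -[2%N](_ : #|[set p; (p.2, p.1)]| = _); last by rewrite cards2 pneq.
apply: subset_leq_card; apply/subsetP => q; rewrite !inE => /orP[]/eqP->.
  by rewrite p1 p2 ap eqxx.
by rewrite p1 p2 adj_sym ap /f setUC eqxx.
Qed.

Section LocalDensity.
Variable R : realFieldType.

Definition quad (T : finType) (b : T -> T -> R) (u : T -> R) : R :=
  \sum_x \sum_y b x y * (u x * u y).

Lemma quad_convex (T : finType) (b : T -> T -> R) (u u0 u1 : T -> R) s :
  (forall x, u x = (1 - s) * u0 x + s * u1 x) ->
  quad b u = (1 - s) * quad b u0 + s * quad b u1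
             - s * (1 - s) * quad b (fun x => u1 x - u0 x).
Proof.
move=> eu; rewrite /quad !mulr_sumr -big_split -sumrB; apply: eq_bigr => x _.
rewrite !mulr_sumr -big_split -sumrB; apply: eq_bigr => y _ /=.
by rewrite !eu; ring.
Qed.

Lemma quad_delta (T : finType) (b : T -> T -> R) v :
  quad b (fun x => (x == v)%:R) = b v v.
Proof.
rewrite /quad (bigD1 v)//= (bigD1 v)//= eqxx !mulr1 big1 ?addr0 => [|y /negbTE->].
  rewrite big1 ?addr0// => x /negbTE->.
  by rewrite big1// => y _; rewrite mul0r mulr0.
by rewrite !mulr0.
Qed.

(* With a nonpositive diagonal the form is concave in each coordinate, so
   coordinates can be rounded one at a time. *)
Lemma quad_round (T : finType) (b : T -> T -> R) (u : T -> R) :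
  (forall v, b v v <= 0) -> (forall x, 0 <= u x <= 1) ->
  exists X : {set T}, quad b (fun x => (x \in X)%:R) <= quad b u.
Proof.
move=> b0 u01.
have round (r : seq T) : exists u', [/\ forall x, 0 <= u' x <= 1,
    forall x, x \in r -> (u' x == 0) || (u' x == 1) & quad b u' <= quad b u].
  elim: r => [|v r [u' [u'01 u'r leu]]]; first by exists u; split.
  pose w c x := if x == v then c else u' x.
  have w01 c : 0 <= c <= 1 -> forall x, 0 <= w c x <= 1.
    by move=> c01 x; rewrite /w; case: ifP.
  have wr c : (c == 0) || (c == 1) ->
      forall x, x \in v :: r -> (w c x == 0) || (w c x == 1).
    move=> c01 x; rewrite inE /w; case: eqP => //= _; exact: u'r.
  have /andP[s0 s1] := u'01 v.
  (* [u'] lies between [w 0] and [w 1], whose difference is the indicator of [v]. As [b v v <= 0],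
     the smaller of the two end values is at most the value at [u']. *)
  have cvx : quad b u' = (1 - u' v) * quad b (w 0) + u' v * quad b (w 1)
      - u' v * (1 - u' v) * b v v.
    rewrite -[b v v]quad_delta (@quad_convex _ _ _ (w 0) (w 1) (u' v)).
      congr (_ - _ * _); rewrite /quad; apply: eq_bigr => x _.
      apply: eq_bigr => y _; rewrite /w.
      by case: (x == v); case: (y == v); rewrite ?subrr ?subr0.
    by move=> x; rewrite /w; case: eqP => [->|_]; ring.
  have min_le : Num.min (quad b (w 0)) (quad b (w 1)) <= quad b u'.
    have bv := b0 v.
    have : 0 <= u' v * (1 - u' v) * - b v v.
      by rewrite !mulr_ge0 ?oppr_ge0 ?subr_ge0.
    set m := Num.min _ _.
    have m0 : m <= quad b (w 0) by rewrite ge_min lexx.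
    have m1 : m <= quad b (w 1) by rewrite ge_min lexx orbT.
    have := ler_wpM2l s0 m1; have s1' : 0 <= 1 - u' v by rewrite subr_ge0.
    have := ler_wpM2l s1' m0; rewrite cvx; lra.
  have [le01|lt10] := leP (quad b (w 0)) (quad b (w 1)).
    exists (w 0); split; [by apply: w01; rewrite lexx ler01 | by apply: wr; rewrite eqxx |].
    by apply: le_trans leu; move: min_le; rewrite min_l.
  exists (w 1); split; [by apply: w01; rewrite ler01 lexx
    | by apply: wr; rewrite eqxx orbT |].
  by apply: le_trans leu; move: min_le; rewrite min_r// ltW.
have [u' [_ u'01 leu]] := round (enum T).
exists [set x | u' x == 1]; rewrite (_ : quad b _ = quad b u')//.
apply: eq_bigr => x _; apply: eq_bigr => y _.
have val01 z : (z \in [set x | u' x == 1])%:R = u' z.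
  rewrite inE; have := u'01 z; rewrite mem_enum => /(_ isT)/orP[]/eqP->.
    by rewrite eq_sym oner_eq0.
  by rewrite eqxx.
by rewrite !val01.
Qed.

End LocalDensity.

Section LocallyDense.
Variables (R : realType) (G : sgraph) (rho d : R).
Hypotheses (rho0 : 0 < rho) (d0 : 0 <= d) (Gdense : locally_dense rho d G).
Hypothesis G0 : (0 < #|G|)%N.
Let n0 : 0 < #|G|%:R :> R. Proof. by rewrite ltr0n. Qed.

Let a (x y : G) : R := (adj x y)%:R.

Lemma locally_dense_le1 : rho <= 1 -> d <= 1.
Proof.
move=> rho1; have := Gdense (X := setT); rewrite cardsT.
rewrite ler_piMl ?ler0n// => /(_ isT) dn.
have := card_edges_in [set: G]; rewrite -(ler_nat R) natrM => en.
have : ((\sum_(x in [set: G]) \sum_(y in [set: G]) adj x y)%N <= #|G| * #|G|)%N.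
  rewrite -(cardsT G) -sum_nat_const.
  apply: leq_sum => x _; rewrite -sum1_card.
  by apply: leq_sum => y _; case: adj.
rewrite -(ler_nat R) natrM => nn.
have : d * (#|G|%:R ^+ 2) <= 1 * (#|G|%:R ^+ 2) by rewrite mul1r expr2; move: dn; rewrite expr2; lra.
by rewrite ler_pM2r ?exprn_gt0.
Qed.

(** Subtracting [d] from the adjacency matrix gives a nonpositive diagonal, so the form can be
    rounded to the indicator of a set. Large sets are handled by local density; for sets below the
    threshold the error term pays for [d * #|X|^2]. *)
Lemma locally_dense_quad (u : G -> R) : (forall x, 0 <= u x <= 1) ->
  d * mean u ^+ 2 - d * rho ^+ 2 <=
  mean (fun x => u x * mean (fun y => a x y * u y)).
Proof.
move=> u01; pose n : R := #|G|%:R; have n_gt0 : 0 < n := n0.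
pose b x y := a x y - d.
have quadE (v : G -> R) : quad b v = quad a v - d * (\sum_x v x) ^+ 2.
  rewrite expr2 mulr_suml mulr_sumr -sumrB; apply: eq_bigr => x _.
  rewrite mulr_sumr mulr_sumr -sumrB; apply: eq_bigr => y _.
  by rewrite /b; ring.
have [|X leX] := quad_round (b := b) _ u01.
  by move=> v; rewrite /b /a adj_irrefl sub0r oppr_le0.
have sumX : \sum_x (x \in X)%:R = #|X|%:R :> R.
  by rewrite -sum1_card natr_sum [RHS]big_mkcond; apply: eq_bigr => x _; case: (x \in X).
have quadX : quad a (fun x => (x \in X)%:R) =
    (\sum_(x in X) \sum_(y in X) adj x y)%N%:R.
  rewrite natr_sum [RHS]big_mkcond; apply: eq_bigr => x _.
  case: (x \in X); last by rewrite big1// => y _; rewrite mul0r mulr0.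
  rewrite natr_sum [RHS]big_mkcond; apply: eq_bigr => y _.
  by case: (y \in X); rewrite ?mulr1 ?mulr0.
have low : - (d * (rho * n) ^+ 2) <= quad b (fun x => (x \in X)%:R).
  rewrite quadE sumX quadX.
  have [big|small] := leP (rho * n) #|X|%:R.
    have := Gdense big; have := card_edges_in X; rewrite -(ler_nat R) natrM.
    have : 0 <= d * (rho * n) ^+ 2 by rewrite mulr_ge0// sqr_ge0.
    lra.
  have : d * #|X|%:R ^+ 2 <= d * (rho * n) ^+ 2.
    have rn0 : 0 <= rho * n by rewrite mulr_ge0// ltW.
    by rewrite ler_wpM2l//; apply: lerXn2r; rewrite ?nnegrE ?ler0n// ltW.
  have : 0 <= (\sum_(x in X) \sum_(y in X) adj x y)%N%:R :> R by rewrite ler0n.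
  lra.
have -> : mean (fun x => u x * mean (fun y => a x y * u y)) = quad a u / n ^+ 2.
  rewrite /mean /quad expr2 invfM mulrA; congr (_ / _).
  rewrite mulr_suml; apply: eq_bigr => x _; rewrite mulrA mulr_sumr; congr (_ / _).
  by apply: eq_bigr => y _; ring.
rewrite ler_pdivlMr ?exprn_gt0// /mean -/n.
rewrite [leLHS](_ : _ = d * (\sum_x u x) ^+ 2 - d * (rho * n) ^+ 2).
  by have := le_trans low leX; rewrite quadE; lra.
by field; rewrite lt0r_neq0.
Qed.

End LocallyDense.

(** * Walk densities and their log-convexity *)

Section Walks.
Variables (R : realFieldType) (T : finType) (a : T -> T -> R).
Hypotheses (a_sym : forall x y, a x y = a y x) (a_ge0 : forall x y, 0 <= a x y).
Variable x0 : T.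
Implicit Types (u v : T -> R) (b : seq bool).

Definition op u x := mean (fun y => a x y * u y).
Definition ip u v := mean (fun x => u x * v x).

Lemma ipC u v : ip u v = ip v u.
Proof. by apply: eq_mean => x; rewrite mulrC. Qed.

Lemma op_adjoint u v : ip u (op v) = ip (op u) v.
Proof.
transitivity (mean (fun x => mean (fun y => u x * (a x y * v y)))).
  by apply: eq_mean => x; rewrite meanZ.
rewrite exchange_mean; apply: eq_mean => y; rewrite -meanZr.
by apply: eq_mean => x; rewrite a_sym; ring.
Qed.

Lemma iter_op_adjoint j u v : ip u (iter j op v) = ip (iter j op u) v.
Proof.
elim: j u v => // j IH u v; rewrite iterS op_adjoint IH; congr ip.
by rewrite -iterSr.
Qed.

(** Cauchy-Schwarz from Lagrange's identity. *)
Lemma ip_sqr_le u v : ip u v ^+ 2 <= ip u u * ip v v.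
Proof.
have sq0 : 0 <= mean (fun x => mean (fun y => (u x * v y - u y * v x) ^+ 2)).
  by apply: mean_ge0 => x; apply: mean_ge0 => y; apply: sqr_ge0.
suff E : mean (fun x => mean (fun y => (u x * v y - u y * v x) ^+ 2)) =
    2 * (ip u u * ip v v - ip u v ^+ 2).
  by move: sq0; rewrite E pmulr_rge0 ?subr_ge0.
have prod (f g : T -> R) : mean (fun x => mean (fun y => f x * g y)) = mean f * mean g.
  by rewrite -meanZr; apply: eq_mean => x; rewrite meanZ.
transitivity (mean (fun x => mean (fun y => (u x * u x) * (v y * v y)))
  + (mean (fun x => mean (fun y => (v x * v x) * (u y * u y)))
  + - 2 * mean (fun x => mean (fun y => (u x * v x) * (u y * v y))))).
  rewrite -meanZ -!meanD; apply: eq_mean => x.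
  by rewrite -meanZ -!meanD; apply: eq_mean => y; ring.
by rewrite !prod /ip; ring.
Qed.

Lemma op_ge0 u : (forall x, 0 <= u x) -> forall x, 0 <= op u x.
Proof. by move=> u0 x; apply: mean_ge0 => y; rewrite mulr_ge0. Qed.

Lemma iter_op_ge0 j u : (forall x, 0 <= u x) -> forall x, 0 <= iter j op u x.
Proof. by move=> u0; elim: j => // j IH x; apply: op_ge0. Qed.

Definition walks j := iter j op (fun=> 1).
Definition walk_density j := mean (walks j).

Lemma walk_density_ge0 j : 0 <= walk_density j.
Proof. by apply: mean_ge0; apply: iter_op_ge0 => _; apply: ler01. Qed.

Lemma ip_walks i j : ip (walks i) (walks j) = walk_density (i + j).
Proof.
rewrite /walks -iter_op_adjoint -iterD.
by apply: eq_mean => x; rewrite mul1r.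
Qed.

Lemma walk_density0 : walk_density 0 = 1.
Proof. exact: mean_cst x0 _. Qed.

Lemma walk_density_sqr i j :
  walk_density (i + j) ^+ 2 <= walk_density (2 * i) * walk_density (2 * j).
Proof. by rewrite !mul2n -!addnn -!ip_walks ip_sqr_le. Qed.

(** The even densities [m] satisfy [m 0 = 1] and [m (l+1)^2 <= m l * m (l+2)], so the l-th root of
    [m l] is nondecreasing in l; exponents are cleared to avoid roots. *)
Lemma even_walk_density_root i j : (i <= j)%N ->
  walk_density (2 * i) ^+ j <= walk_density (2 * j) ^+ i.
Proof.
pose m i := walk_density (2 * i).
have m0 l : 0 <= m l by apply: walk_density_ge0.
have step l : m l ^+ l.+1 <= m l.+1 ^+ l.
  elim: l => [|l IH]; first by rewrite /m muln0 walk_density0 expr1n.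
  have conv : m l.+1 ^+ 2 <= m l * m l.+2.
    rewrite /m -[X in X ^+ 2](_ : walk_density (l + l.+2) = _).
      exact: walk_density_sqr.
    by congr walk_density; lia.
  have [z|nz] := eqVneq (m l.+1) 0; first by rewrite z expr0n/= exprn_ge0.
  have pos : 0 < m l.+1 ^+ l by rewrite exprn_gt0// lt_neqAle eq_sym nz m0.
  (* Multiplied by [m l.+1 ^+ l], the left side becomes a power of [m l.+1 ^+ 2], to which convexity
     and then the induction hypothesis apply. *)
  rewrite -(ler_pM2l pos) -exprD.
  rewrite (_ : (l + l.+2 = 2 * l.+1)%N); last by lia.
  rewrite exprM; apply: (le_trans (y := (m l * m l.+2) ^+ l.+1)).
    by apply: lerXn2r; rewrite ?nnegrE ?exprn_ge0 ?(mulr_ge0 (m0 _) (m0 _)).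
  by rewrite exprMn ler_wpM2r ?exprn_ge0.
move=> /subnK <-; elim: (j - i)%N => [|l IH]; first by rewrite add0n.
rewrite addSn; set k := (l + i)%N in IH *.
have [k0|k_gt0] := posnP k.
  by rewrite (_ : i = 0%N) ?muln0 ?walk_density0 ?expr1n//; move: k0; rewrite /k; lia.
rewrite -(ler_pXn2r k_gt0) ?nnegrE ?exprn_ge0 -/(m i) -/(m k.+1)//.
rewrite -!exprM mulnC exprM; apply: (le_trans (y := (m k ^+ i) ^+ k.+1)).
  by apply: lerXn2r; rewrite ?nnegrE ?exprn_ge0.
rewrite -exprM mulnC exprM; apply: (le_trans (y := (m k.+1 ^+ k) ^+ i)).
  by apply: lerXn2r; rewrite ?nnegrE ?exprn_ge0.
by rewrite -!exprM mulnC.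
Qed.

(** Cutting a walk of length [j] near its middle and applying Cauchy-Schwarz bounds its squared
    density by two even ones, of lengths at most [2 * k]; this covers odd [j]. *)
Lemma walk_density_root j k : (j <= 2 * k)%N ->
  walk_density j ^+ (2 * k) <= walk_density (2 * k) ^+ j.
Proof.
move=> jk; pose i := j./2; pose i' := uphalf j.
have ij : (i + i' = j)%N by rewrite /i /i'; lia.
rewrite -ij exprM exprD.
apply: (le_trans (y := (walk_density (2 * i) * walk_density (2 * i')) ^+ k)).
  apply: lerXn2r; rewrite ?nnegrE ?sqr_ge0//; last exact: walk_density_sqr.
  by apply: mulr_ge0; apply: walk_density_ge0.
rewrite exprMn ler_pM ?exprn_ge0 ?walk_density_ge0 ?even_walk_density_root//.
  by rewrite /i; lia.
by rewrite /i'; lia.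
Qed.

(* Walks whose i-th step follows an edge only if the i-th bit of b is set, and
   is unconstrained otherwise, weighted by g at the endpoint. *)
Definition broken_walks b (g : T -> R) : T -> R :=
  foldr (fun (c : bool) f => if c then op f else fun=> mean f) g b.

Lemma broken_walks_ge0 b g : (forall x, 0 <= g x) -> forall x, 0 <= broken_walks b g x.
Proof.
move=> g0; elim: b => //= -[] b IH x; first exact: op_ge0.
exact: mean_ge0.
Qed.

Lemma broken_walks_nseq j g : broken_walks (nseq j true) g = iter j op g.
Proof. by elim: j => //= j ->. Qed.

(** [j] counts the edges of the current run. A set bit moves one operator to the left by adjointness
    and lengthens the run; an unset bit splits off the factor [walk_density j] and starts a new
    run. *)
Lemma broken_walk_density_le b k : (size b <= 2 * k)%N ->
  mean (broken_walks b (fun=> 1)) ^+ (2 * k) <= walk_density (2 * k) ^+ count id b.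
Proof.
suff gen j : (j + size b <= 2 * k)%N ->
    ip (walks j) (broken_walks b (fun=> 1)) ^+ (2 * k) <=
    walk_density (2 * k) ^+ (j + count id b).
  have -> : mean (broken_walks b (fun=> 1)) =
      ip (walks 0) (broken_walks b (fun=> 1)).
    by apply: eq_mean => x; rewrite mul1r.
  exact: (gen 0%N).
elim: b j => [|c b IH] j jk /=.
  have -> : ip (walks j) (fun=> 1) = walk_density j.
    by apply: eq_mean => x; rewrite mulr1.
  by rewrite addn0 walk_density_root//; lia.
case: c jk => /= jk.
  rewrite op_adjoint add1n -addSnnS; apply: (IH j.+1).
  by rewrite addSnnS.
have -> : ip (walks j) (fun=> mean (broken_walks b (fun=> 1))) =
    walk_density j * ip (walks 0) (broken_walks b (fun=> 1)).
  by rewrite /ip meanZr; congr (_ * _); apply: eq_mean => x; rewrite mul1r.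
rewrite exprMn add0n exprD ler_pM ?exprn_ge0 ?walk_density_ge0//.
- by apply: mean_ge0 => x; rewrite mul1r broken_walks_ge0// => _; apply: ler01.
- by apply: walk_density_root; lia.
- by apply: (IH 0%N); lia.
Qed.

Lemma mean_tupleS n (F : n.+1.-tuple T -> R) :
  mean F = mean (fun x => mean (fun s : n.-tuple T => F [tuple of x :: s])).
Proof.
rewrite mean_pair; pose f (p : T * n.-tuple T) := [tuple of p.1 :: p.2].
have bf : bijective f.
  exists (fun s => (thead s, [tuple of behead s])).
    by case=> x s; congr pair; apply: val_inj.
  by move=> s; rewrite /f /= -tuple_eta.
by rewrite (reindex_mean _ bf).
Qed.

Lemma mean_broken_walk b (g : T -> R) x :
  mean (fun s : (size b).-tuple T =>
    (\prod_(i < size b) (if nth false b i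
       then a (nth x0 (x :: s) i) (nth x0 (x :: s) i.+1) else 1)) *
    g (nth x0 (x :: s) (size b))) = broken_walks b g x.
Proof.
elim: b x => [|c b IH] x.
  rewrite (eq_mean (F' := fun=> g x)) ?(mean_cst [tuple])// => s.
  by rewrite big_ord0 mul1r.
rewrite mean_tupleS /=.
transitivity (mean (fun y => (if c then a x y else 1) * broken_walks b g y)).
  apply: eq_mean => y; rewrite -IH -meanZ; apply: eq_mean => s.
  by rewrite big_ord_recl mulrA.
by case: c => //; apply: eq_mean => y; rewrite mul1r.
Qed.

(** The walk visits the vertices 0 to [n], and [g] carries the closing step from the last back to
    the first. The point [x0] only serves as the default of [nth]. *)
Lemma mean_broken_cycle n b (g : T -> T -> R) : size b = n ->
  mean (fun s : n.+1.-tuple T =>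
    (\prod_(i < n) (if nth false b i
       then a (nth x0 s i) (nth x0 s i.+1) else 1)) *
    g (nth x0 s n) (nth x0 s 0)) = mean (fun x => broken_walks b (g^~ x) x).
Proof.
move=> <-; rewrite mean_tupleS; apply: eq_mean => x.
by rewrite -mean_broken_walk.
Qed.

End Walks.

(** * Lower bound for the density of an odd cycle *)

Section OddCycle.
Variables (R : realFieldType) (T : finType) (a : T -> T -> R) (x0 : T).
Hypotheses (a_sym : forall x y, a x y = a y x) (a01 : forall x y, 0 <= a x y <= 1).

Lemma iter_op_le1 j (u : T -> R) : (forall x, 0 <= u x <= 1) ->
  forall x, 0 <= iter j (op a) u x <= 1.
Proof.
move=> u01; elim: j => // j IH x /=; rewrite op_ge0/=.
- rewrite -[1](mean_cst x0); apply: ler_mean => y.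
  have /andP[u0 u1] := IH y; have /andP[a0 a1] := a01 x y.
  by rewrite -[1]mulr1 ler_pM.
- by move=> y z; case/andP: (a01 y z).
- by move=> y; case/andP: (IH y).
Qed.

(* Fixing one vertex of the cycle, the two walks of length k issuing from it
   are joined by an edge, to which the density of quadratic forms applies. *)
Lemma odd_cycle_density k d c :
  (forall u : T -> R, (forall x, 0 <= u x <= 1) ->
     d * mean u ^+ 2 - c <= ip u (op a u)) ->
  d * walk_density a (2 * k.+1) - c <=
  mean (fun x => iter (2 * k.+1) (op a) (a^~ x) x).
Proof.
move=> dense; rewrite [(2 * k.+1)%N]mul2n -addnn -ip_walks//.
rewrite /ip -meanZ -[c](mean_cst x0) -mulN1r -meanZ -meanD.
(* The seed [a^~ x] already counts one step, so [u y] is the density of walks of [k.+1] steps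
   between [x] and [y]. *)
apply: ler_mean => x; pose u := iter k (op a) (a^~ x).
have mu : mean u = walks a k.+1 x.
  transitivity (ip (walks a 0) u).
    by apply: eq_mean => y; rewrite mul1r.
  rewrite iter_op_adjoint// ipC /= /op /ip; apply: eq_mean => y.
  by rewrite a_sym.
have -> : iter (k.+1 + k.+1) (op a) (a^~ x) x = ip u (op a u).
  rewrite /u -iter_op_adjoint// -iterS -iterD addSn iterS.
  by apply: eq_mean => y; rewrite [a x y]a_sym.
rewrite mulN1r -mu -expr2; apply: dense.
by apply: iter_op_le1 => y; apply: a01.
Qed.

End OddCycle.

(** Distinct coordinates of a uniform map form a uniform tuple: exchanging an independent tuple with
    these coordinates is an involution on pairs. *)
Lemma mean_restrict (R : realFieldType) (V T : finType) m (c : 'I_m -> V)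
    (F : m.-tuple T -> R) (x0 : T) : injective c ->
  mean (fun h : {ffun V -> T} => F [tuple h (c i) | i < m]) = mean F.
Proof.
move=> c_inj.
pose override (s : m.-tuple T) (h : {ffun V -> T}) : {ffun V -> T} :=
  [ffun v => if [pick i | c i == v] is Some i then tnth s i else h v].
pose restrict (h : {ffun V -> T}) := [tuple h (c i) | i < m].
have overrideK s h : restrict (override s h) = s.
  apply: eq_from_tnth => i; rewrite tnth_mktuple ffunE; case: pickP => [j /eqP/c_inj->//|].
  by move=> /(_ i); rewrite eqxx.
have override_restrict s h : override (restrict h) (override s h) = h.
  apply/ffunP => v; rewrite !ffunE; case: pickP => [j /eqP<-|//].
  by rewrite tnth_mktuple.
pose swap (p : m.-tuple T * {ffun V -> T}) := (restrict p.2, override p.1 p.2).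
have swapK : involutive swap.
  by case=> s h; rewrite /swap /= overrideK override_restrict.
transitivity (mean (fun _ : m.-tuple T => mean (fun h => F (restrict h)))).
  by rewrite (mean_cst [tuple x0 | i < m]).
rewrite mean_pair (reindex_mean _ (inv_bij swapK)).
transitivity (mean (fun s => mean (fun _ : {ffun V -> T} => F s))).
  by rewrite mean_pair; apply: eq_mean => -[s h]; rewrite /= overrideK.
by apply: eq_mean => s; rewrite (mean_cst [ffun=> x0]).
Qed.

(** * Labelled cycles inside a graph *)

Definition cycle_labelling n (H : sgraph) (c : 'I_n.+1 -> H) (X : {set H}) :=
  [/\ injective c, X = [set c i | i in 'I_n.+1]
    & forall i j, adj (c i) (c j) = cycle_adj i j].

Lemma ordS_add n (i v : 'I_n.+1) : ordS (i + v) = ordS i + v.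
Proof. by apply: val_inj; rewrite /= modnDml -addn1 modnDml -[(i.+1)%N]addn1 addnAC. Qed.

Lemma ordS_neq n (i : 'I_n.+2) : i != ordS i.
Proof.
apply/eqP => /(congr1 val) /=; have := ltn_ord i; rewrite ltnS leq_eqVlt.
by case/predU1P => [->|lt_i]; rewrite ?modnn ?modn_small//; lia.
Qed.

Lemma cycle_adjD n (i j v : 'I_n.+1) : cycle_adj (i + v) (j + v) = cycle_adj i j.
Proof.
by rewrite /cycle_adj !ordS_add !(inj_eq (addIr v)).
Qed.

Lemma isomorphic_labelling n (H : sgraph) (X : {set H}) :
  isomorphic (induced X) (cycle_graph n.+1) ->
  exists c : 'I_n.+1 -> H, cycle_labelling c X.
Proof.
case=> f [[g fK gK] fadj]; exists (fun i => val (g i)); split.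
- by move=> i j /val_inj/(can_inj gK).
- apply/setP => x; apply/idP/imsetP => [xX|[i _ ->]]; last exact: valP.
  by exists (f (Sub x xX)); rewrite ?fK.
- by move=> i j; have := fadj (g i) (g j); rewrite !gK => /esym; apply.
Qed.

Section CycleInGraph.
Variables (n : nat) (H : sgraph).
Hypothesis n2 : (1 < n)%N.
Implicit Types (c : 'I_n.+1 -> H) (X S : {set H}).

Lemma cycle_labelling_card c X : cycle_labelling c X -> #|X| = n.+1.
Proof. by case=> c_inj -> _; rewrite card_imset// card_ord. Qed.

(** Indices form an additive group whose translations are rotations. A vertex missing from [S] is
    rotated to the last position, so that [S] spans no closing step and becomes a broken walk. *)
Lemma cycle_labelling_rotate c X S : cycle_labelling c X -> S \proper X ->
  exists2 c' : 'I_n.+1 -> H, cycle_labelling c' X & c' ord_max \notin S.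
Proof.
move=> [c_inj eX cadj] /properP[SX [x]]; rewrite {1}eX => /imsetP[v _ ->] vS.
exists (fun i => c (i + (v - ord_max))); last by rewrite addrC subrK.
split=> [i j /c_inj/addIr//||i j]; last by rewrite cadj cycle_adjD.
rewrite eX; apply/setP => y; apply/imsetP/imsetP => -[i _ ->].
  by exists (i - (v - ord_max)); rewrite ?subrK.
by exists (i + (v - ord_max)).
Qed.

Definition cycle_step c S (i : 'I_n.+1) := (c i \in S) && (c (ordS i) \in S).

Lemma labelling_adj c X i : cycle_labelling c X -> adj (c i) (c (ordS i)).
Proof.
case=> _ _ ->; rewrite /cycle_adj eqxx andbT.
by case: n n2 i => // n' _ i; apply: ordS_neq.
Qed.

Lemma hom_on_cycle (G : sgraph) c X S (h : {ffun H -> G}) :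
  cycle_labelling c X -> S \subset X ->
  hom_on S h = [forall i, cycle_step c S i ==> adj (h (c i)) (h (c (ordS i)))].
Proof.
move=> lab /subsetP SX; apply/hom_onP/forallP => [hS i|hc x y xS yS].
  by apply/implyP => /andP[iS iS']; apply: hS => //; apply: labelling_adj lab.
case: lab (SX _ xS) (SX _ yS) => _ -> cadj /imsetP[i _ ex] /imsetP[j _ ey].
rewrite {}ex {}ey in xS yS *; rewrite cadj => /andP[_ /orP[]/eqP e].
  by have /implyP := hc i; rewrite e; apply; rewrite /cycle_step xS -e.
by have /implyP := hc j; rewrite adj_sym e; apply; rewrite /cycle_step yS -e.
Qed.

Lemma card_edges_in_cycle c X S : cycle_labelling c X -> S \subset X ->
  #|edges_in S| = (\sum_(i < n.+1) cycle_step c S i)%N.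
Proof.
move=> lab /subsetP SX; have [c_inj eX cadj] := lab.
pose f i := [set c i; c (ordS i)].
have -> : edges_in S = [set f i | i : 'I_n.+1 & cycle_step c S i].
  apply/setP => e; rewrite inE; apply/andP/imsetP => [[/imsetP[[x y]]]|[i]].
    rewrite inE /= => xy ->; rewrite subUset !sub1set => /andP[xS yS].
    move: (SX _ xS) (SX _ yS); rewrite eX => /imsetP[i _ ex] /imsetP[j _ ey].
    rewrite {}ex {}ey in xS yS xy *.
    move: xy; rewrite cadj => /andP[_ /orP[]/eqP eij].
      by exists i; rewrite ?inE /cycle_step /f -eij ?xS.
    by exists j; rewrite ?inE /cycle_step /f -eij ?yS// setUC.
  rewrite inE => /andP[iS iS'] ->; split; last by rewrite subUset !sub1set iS.
  apply/imsetP; exists (c i, c (ordS i)) => //.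
  by rewrite inE; apply: labelling_adj lab.
rewrite card_in_imset => [|i j _ _ /setP eij].
  by rewrite -sum1_card big_mkcond; apply: eq_bigr => i _; rewrite inE; case: ifP.
(* Two distinct indices giving the same edge would each be the successor of the other, which is
   impossible in a cycle of length at least 3. *)
have := eij (c i); rewrite !inE eqxx /= !(inj_eq c_inj) => /esym/orP[/eqP//|/eqP ei].
have := eij (c (ordS i)); rewrite !inE eqxx orbT !(inj_eq c_inj) => /esym/orP[/eqP ej|].
  exfalso; move: ei; rewrite -ej => /(congr1 val) /=.
  have := ltn_ord i; move: (i : nat) => {eij ej lab cadj c_inj eX SX f} m.
  rewrite ltnS leq_eqVlt => /predU1P[->|mn].
    by rewrite modnn modn_small; lia.
  rewrite [(m.+1 %% _)%N]modn_small// => e.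
  move: mn; rewrite leq_eqVlt => /predU1P[mn|mn]; move: e.
    by rewrite mn modnn; lia.
  by rewrite modn_small; lia.
by rewrite (inj_eq (can_inj (@ordSK _))) => /eqP.
Qed.

End CycleInGraph.

(** * Densities of cycles and of their induced subgraphs *)

Section CycleDensity.
Variables (R : realType) (n : nat) (H G : sgraph).
Hypotheses (n2 : (1 < n)%N).
Variable x0 : G.
Implicit Types (c : 'I_n.+1 -> H) (X S : {set H}).

Let a (x y : G) : R := (adj x y)%:R.

Lemma prod_indicator (I : finType) (P : pred I) :
  \prod_(i : I) (P i)%:R = [forall i, P i]%:R :> R.
Proof.
have [/forallP allP|/forallPn[i /negbTE Pi]] := boolP [forall i, P i].
  by rewrite big1// => i _; rewrite allP.
by rewrite (bigD1 i)//= Pi mul0r.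
Qed.

(** The cycle is cut open between its last and first vertices: the first [n] steps become the bits
    of [b], and the closing step becomes the terminal weight. *)
Lemma mean_hom_on_cycle c X S : cycle_labelling c X -> S \subset X ->
  let b := [seq cycle_step c S (widen_ord (leqnSn n) i) | i <- enum 'I_n] in
  mean (fun h : {ffun H -> G} => (hom_on S h)%:R) =
  mean (fun x => broken_walks a b
    (fun y => if cycle_step c S ord_max then a y x else 1) x).
Proof.
move=> lab SX b; have [c_inj _ _] := lab.
have sb : size b = n by rewrite size_map size_enum_ord.
rewrite -(mean_broken_cycle a x0 _ sb) -(mean_restrict _ x0 c_inj).
apply: eq_mean => h; set s := [tuple h (c i) | i < n.+1].
have nth_s (i : 'I_n.+1) : nth x0 s i = h (c i).
  by rewrite -tnth_nth tnth_mktuple.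
rewrite (hom_on_cycle n2 _ lab SX) -prod_indicator big_ord_recr /=.
congr (_ * _); last first.
  rewrite (nth_s ord_max) (nth_s ord0).
  rewrite (_ : ordS ord_max = ord0); last by apply: val_inj; rewrite /= modnn.
  by case: cycle_step.
apply: eq_bigr => i _; rewrite (nth_map i) ?size_enum_ord// nth_ord_enum.
have eS : ordS (widen_ord (leqnSn n) i) = i.+1 :> nat.
  by rewrite /= modn_small// ltnS.
by rewrite -eS (nth_s (widen_ord (leqnSn n) i)) nth_s; case: cycle_step.
Qed.

Lemma mean_hom_cycle c X : cycle_labelling c X ->
  mean (fun h : {ffun H -> G} => (hom_on X h)%:R) =
  mean (fun x => iter n (op a) (a^~ x) x).
Proof.
move=> lab; have inX i : cycle_step c X i.
  by case: lab => _ -> _; rewrite /cycle_step !imset_f.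
rewrite (mean_hom_on_cycle lab (subxx _)); apply: eq_mean => x.
rewrite inX -broken_walks_nseq; congr (broken_walks _ _ _ _).
apply: (@eq_from_nth _ false) => [|i]; rewrite size_map size_enum_ord ?size_nseq// => ni.
by rewrite (nth_map (Ordinal ni)) ?size_enum_ord// inX nth_nseq ni.
Qed.

(** After a rotation the terminal weight is constantly 1, and the set bits of [b] count the edges
    inside [S]. *)
Lemma mean_hom_proper c X S k : cycle_labelling c X -> S \proper X -> n = (2 * k)%N ->
  mean (fun h : {ffun H -> G} => (hom_on S h)%:R) ^+ (2 * k) <=
  walk_density a (2 * k) ^+ #|edges_in S|.
Proof.
move=> lab0 SX nk; have [{lab0}c' lab nS] := cycle_labelling_rotate lab0 SX.
rewrite (mean_hom_on_cycle lab (proper_sub SX)) (card_edges_in_cycle n2 lab (proper_sub SX)).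
set b := [seq _ | _ <- _].
have last_step : cycle_step c' S ord_max = false by rewrite /cycle_step (negbTE nS).
rewrite big_ord_recr /= last_step addn0.
rewrite (_ : \sum_(i < n) _ = count id b)%N; last first.
  rewrite -sum1_count big_map big_enum_cond big_mkcond /=.
  by rewrite [RHS]big_mkcond; apply: eq_bigr => i _; case: cycle_step.
have sb : size b = n by rewrite size_map size_enum_ord.
apply: broken_walk_density_le => //; last by rewrite sb nk.
by move=> x y; rewrite /a adj_sym.
Qed.

Lemma card_edges_in_whole c X : cycle_labelling c X -> #|edges_in X| = n.+1.
Proof.
move=> lab; rewrite (card_edges_in_cycle n2 lab (subxx _)).
rewrite (eq_bigr (fun=> 1%N)) ?sum1_card ?card_ord// => i _.
by case: lab => _ -> _; rewrite /cycle_step !imset_f.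
Qed.

Lemma card_edges_in_proper c X S : cycle_labelling c X -> S \proper X ->
  (#|edges_in S| <= n)%N.
Proof.
move=> lab0 SX; have [{lab0}c' lab nS] := cycle_labelling_rotate lab0 SX.
rewrite (card_edges_in_cycle n2 lab (proper_sub SX)) big_ord_recr /=.
rewrite {2}/cycle_step (negbTE nS) addn0 -[leqRHS]card_ord -sum1_card.
by apply: leq_sum => i _; case: cycle_step.
Qed.

End CycleDensity.

(** * Counting edges along a gluing *)

Lemma edges_inI (H : sgraph) (X Z : {set H}) :
  edges_in X :&: edges_in Z = edges_in (X :&: Z).
Proof.
by apply/setP => e; rewrite !inE subsetI; case: (e \in edges H).
Qed.

Lemma edges_inS (H : sgraph) (X Z : {set H}) :
  X \subset Z -> edges_in X \subset edges_in Z.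
Proof.
move=> XZ; apply/subsetP => e; rewrite !inE => /andP[-> eX] /=.
exact: subset_trans eX XZ.
Qed.

(** An edge shared by the new bag and an earlier one has both ends in the attaching bag, so each
    gluing adds exactly the edges of the new bag outside the overlap. *)
Lemma gluing_edges (H : sgraph) link (X0 : {set H}) l : gluing link X0 l ->
  (#|edges_in X0| + \sum_(p <- l) (#|edges_in p.1| - #|edges_in (p.1 :&: p.2)|)
   <= #|edges H|)%N.
Proof.
move=> gl; pose U l := \bigcup_(Z <- parts X0 l) edges_in Z.
have UE : U l \subset edges H.
  rewrite /U bigcup_seq; apply/bigcupsP => Z _.
  by apply/subsetP => e; rewrite inE => /andP[].
apply: leq_trans (subset_leq_card UE) => {UE}.
elim: gl => {l} [|X Y l gl IH Yl XUY lXY].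
  by rewrite big_nil addn0 /U /parts /= big_seq1.
have -> : U ((X, Y) :: l) = edges_in X :|: U l by rewrite /U /= big_cons.
rewrite cardsU big_cons /=.
have -> : edges_in X :&: U l = edges_in (X :&: Y).
  apply/eqP; rewrite eqEsubset; apply/andP; split; last first.
    rewrite subsetI edges_inS ?subsetIl//=.
    apply: (@subset_trans _ _ (mem (edges_in Y))); first by rewrite edges_inS ?subsetIr.
    by rewrite /U (big_rem _ Yl) subsetUl.
  apply/subsetP => e /setIP[eX]; rewrite /U bigcup_seq => /bigcupP[Z Zl eZ].
  have : e \in edges_in (X :&: Z) by rewrite -edges_inI inE eX eZ.
  apply/subsetP/edges_inS; rewrite subsetI subsetIl/=; apply: subset_trans XUY.
  by apply: setIS; rewrite (big_rem _ Zl) subsetUl.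
have := subset_leq_card (edges_inS (subsetIl X Y)); move: IH.
move: (\sum_(_ <- _) _)%N #|U l| #|edges_in X0| #|edges_in X| #|edges_in (X :&: Y)|.
by move=> *; lia.
Qed.

Lemma onem_expr_ge (R : realDomainType) (x : R) n :
  0 <= x <= 1 -> 1 - n%:R * x <= (1 - x) ^+ n.
Proof.
move=> /andP[x0 x1]; elim: n => [|n IH]; first by rewrite mul0r subr0 expr0.
rewrite exprS; have h : 0 <= 1 - x by rewrite subr_ge0.
apply: le_trans (ler_wpM2l h IH).
have : 0 <= n%:R * (x * x) by rewrite !mulr_ge0.
by rewrite -natr1; lra.
Qed.

(** * Assembling the bound in a locally dense graph *)

Section DenseGraph.
Variables (R : realType) (k : nat) (H G : sgraph) (rho d eps : R) (x0 : G).
Hypotheses (k0 : (0 < k)%N) (rho0 : 0 < rho) (rho1 : rho <= 1) (d0 : 0 < d).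
Hypothesis Gdense : locally_dense rho d G.
Hypotheses (eps0 : 0 <= eps) (eps1 : eps < 1).
Hypothesis rho_eps : rho <= eps * d ^+ (2 * k).

Let a (x y : G) : R := (adj x y)%:R.
Let W := walk_density a (2 * k).
Let G0 : (0 < #|G|)%N. Proof. by apply/card_gt0P; exists x0. Qed.
Let k2 : (1 < 2 * k)%N. Proof. lia. Qed.
Let a_sym x y : a x y = a y x. Proof. by rewrite /a adj_sym. Qed.
Let a01 x y : 0 <= a x y <= 1. Proof. by rewrite /a ler0n lern1; case: adj. Qed.
Let a0 x y : 0 <= a x y. Proof. by case/andP: (a01 x y). Qed.

Lemma walk_density1_ge : d <= walk_density a 1.
Proof.
have := Gdense (X := setT); rewrite cardsT ler_piMl ?ler0n// => /(_ isT) dn.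
have := card_edges_in [set: G]; rewrite -(ler_nat R) natrM => en.
have n_gt0 : 0 < #|G|%:R :> R by rewrite ltr0n.
have -> : walk_density a 1 =
    (\sum_(x in [set: G]) \sum_(y in [set: G]) adj x y)%N%:R / #|G|%:R ^+ 2.
  rewrite /walk_density /walks /= /op /mean expr2 invfM mulrA; congr (_ / _).
  rewrite -mulr_suml; congr (_ / _); rewrite natr_sum.
  apply: eq_big => [x|x _]; first by rewrite inE.
  rewrite natr_sum; apply: eq_big => [y|y _]; first by rewrite inE.
  by rewrite mulr1.
rewrite ler_pdivlMr ?exprn_gt0//; move: dn en; lra.
Qed.

Lemma walk_density_ge : d ^+ (2 * k) <= W.
Proof.
have w1 := walk_density1_ge; have /= := walk_density_root a_sym a0 x0 (j := 1) (k := k).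
rewrite expr1 => W1; apply: le_trans (W1 _); last by lia.
by apply: lerXn2r; rewrite ?nnegrE ?(ltW d0)//; apply: le_trans w1; apply: ltW.
Qed.

(** The error [d * rho^2] is at most [d * rho], hence at most [eps * d * W] by [rho_eps] and
    [walk_density_ge]. *)
Lemma hom_cycle_ge n (c : 'I_n.+1 -> H) X : n = (2 * k)%N -> cycle_labelling c X ->
  (1 - eps) * d * W <= mean (fun h : {ffun H -> G} => (hom_on X h)%:R).
Proof.
move=> nk; case: _ / (esym nk) c => c lab.
rewrite (mean_hom_cycle _ k2 x0 lab) -/a.
case: k k0 rho_eps @W walk_density_ge => // k' _ rho_eps' W' W'ge.
apply: le_trans (odd_cycle_density x0 a_sym a01 k' (d := d) (c := d * rho ^+ 2) _).
  have : rho ^+ 2 <= eps * W'.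
    apply: le_trans (_ : rho <= _).
      by rewrite expr2 ler_piMl// ltW.
    by apply: le_trans rho_eps' _; rewrite ler_wpM2l.
  move/(ler_wpM2l (ltW d0)); rewrite -/W'; lra.
by move=> u u01; apply: locally_dense_quad => //; apply: ltW.
Qed.

(** After raising to the power [2 * k], the first factor is at most [W ^+ (2 * k - s)] and the
    second at most [W ^+ s]. *)
Lemma hom_proper_le n (c : 'I_n.+1 -> H) X (S : {set H}) : n = (2 * k)%N ->
  cycle_labelling c X -> S \proper X ->
  d ^+ (2 * k - #|edges_in S|) *
    mean (fun h : {ffun H -> G} => (hom_on S h)%:R) <= W.
Proof.
move=> nk lab SX; set tS := mean _; set s := #|edges_in S|.
have s_le : (s <= 2 * k)%N by rewrite -nk; apply: card_edges_in_proper lab SX; rewrite nk.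
have tS0 : 0 <= tS by apply: mean_ge0.
have W0 : 0 <= W by apply: walk_density_ge0.
have n1 : (1 < n)%N by rewrite nk.
rewrite -(ler_pXn2r (ltnW k2)) ?nnegrE ?(mulr_ge0 _ tS0) ?exprn_ge0 ?(ltW d0)//.
rewrite exprMn -exprM mulnC exprM.
apply: (@le_trans _ _ (W ^+ (2 * k - s) * W ^+ s)); last by rewrite -exprD subnK.
apply: ler_pM; rewrite ?exprn_ge0 ?(ltW d0)//.
  by apply: lerXn2r; rewrite ?nnegrE ?exprn_ge0 ?(ltW d0)//; apply: walk_density_ge.
exact: mean_hom_proper lab SX nk.
Qed.

Lemma gluing_hom_density X0 l :
  gluing (@linked H) X0 l ->
  {in parts X0 l, forall Z, isomorphic (induced Z) (cycle_graph (2 * k).+1)} ->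
  (forall x y : H, adj x y ->
    exists2 Z, Z \in parts X0 l & (x \in Z) && (y \in Z)) ->
  (1 - eps) ^+ (size l).+1 * d ^+ #|edges H| <= hom_density R H G.
Proof.
move=> gl isoZ cover.
have lab Z : Z \in parts X0 l -> exists c : 'I_(2 * k).+1 -> H, cycle_labelling c Z.
  by move=> /isoZ/isomorphic_labelling.
have X0l : X0 \in parts X0 l by rewrite mem_rcons inE eqxx.
have [c0 lab0] := lab _ X0l.
pose t := mean (fun h : {ffun H -> G} => (hom_on X0 h)%:R) : R.
have tZ : {in parts X0 l, forall Z,
    mean (fun h : {ffun H -> G} => (hom_on Z h)%:R) = t}.
  move=> Z /lab[c labZ].
  by rewrite /t (mean_hom_cycle R k2 x0 labZ) (mean_hom_cycle R k2 x0 lab0).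
have t_ge : (1 - eps) * d * W <= t by apply: hom_cycle_ge lab0.
have e0 : 0 < 1 - eps by rewrite subr_gt0.
have W0 : 0 < W by apply: lt_le_trans walk_density_ge; rewrite exprn_gt0.
have t0 : 0 < t by apply: lt_le_trans t_ge; apply: mulr_gt0 W0; apply: mulr_gt0.
have d1 : d <= 1 by apply: locally_dense_le1 Gdense G0 rho1.
have -> : hom_density R H G = mean (fun h : {ffun H -> G} =>
    (all (fun Z => hom_on Z h) (parts X0 l))%:R).
  rewrite mean_hom_density; apply: eq_mean => h; congr (nat_of_bool _)%:R.
  apply/forallP/allP => [hh Z Zl|hh x].
    by apply/hom_onP => x y _ _; have /forallP/(_ y)/implyP := hh x.
  apply/forallP => y; apply/implyP => xy; have [Z Zl /andP[xZ yZ]] := cover x y xy.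
  by have /hom_onP := hh Z Zl; apply.
apply: le_trans (gluing_bound (ind := @hom_on H G) (@hom_on_depends R H G)
  (@hom_onS H G) (@linked_cond R H G) gl t0 tZ).
have E0 : #|edges_in X0| = (2 * k).+1 by apply: card_edges_in_whole lab0.
have := gluing_edges gl; rewrite E0 => eH.
pose ex (p : {set H} * {set H}) := (#|edges_in p.1| - #|edges_in (p.1 :&: p.2)|)%N.
apply: (@le_trans _ _ (((1 - eps) * d ^+ (2 * k).+1) *
    \prod_(p <- l) ((1 - eps) * d ^+ ex p))).
  have -> : \prod_(p <- l) ((1 - eps) * d ^+ ex p) =
      (1 - eps) ^+ size l * d ^+ (\sum_(p <- l) ex p)%N.
    elim: (l) => [|p l' IH]; first by rewrite !big_nil mulr1.
    by rewrite !big_cons IH /= exprS exprD mulrACA.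
  (* The exponents of [d] add up to at most the number of edges of [H], and [d <= 1]. *)
  rewrite mulrACA -exprS -exprD.
  rewrite ler_wpM2l ?exprn_ge0 ?(ltW e0)//.
  by rewrite ler_wiXn2l// ltW.
apply: ler_pM.
- by rewrite mulr_ge0 ?exprn_ge0 ?ltW.
- by apply: prodr_ge0 => p _; rewrite mulr_ge0 ?exprn_ge0 ?ltW.
- apply: le_trans t_ge; rewrite exprS mulrA ler_wpM2l ?walk_density_ge//.
  by rewrite mulr_ge0 ?ltW.
rewrite big_seq [leRHS]big_seq; apply: ler_prod => p pl.
rewrite mulr_ge0 ?exprn_ge0 ?(ltW e0) ?(ltW d0)//=.
have [Xl Yl [XY _]] := gluing_link gl pl.
have [c labX] := lab _ Xl; have [c' labY] := lab _ Yl.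
set S := p.1 :&: p.2; set tS := mean _.
(* Linked bags are distinct and of equal size, so neither contains the other. *)
have SX : S \proper p.1.
  rewrite properEneq subsetIl andbT; apply/eqP => /setIidPl XsubY; apply: XY.
  apply/eqP; rewrite eqEcard XsubY.
  by rewrite (cycle_labelling_card labX) (cycle_labelling_card labY) leqnn.
have tS0 : 0 < tS.
  apply: lt_le_trans t0 _; rewrite -(tZ _ Xl); apply: ler_mean => h.
  rewrite ler_nat; case hX: (hom_on p.1 h) => //.
  by rewrite (hom_onS (subsetIl _ _) hX).
have := hom_proper_le (erefl _) labX SX; rewrite -/tS => le_tS.
have s_le : (#|edges_in S| <= 2 * k)%N by apply: card_edges_in_proper labX SX.
rewrite ler_pdivlMr//; apply: le_trans t_ge.
rewrite /ex (card_edges_in_whole k2 labX) -/S subSn// exprS -!mulrA.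
by rewrite ler_wpM2l ?(ltW e0)// ler_wpM2l ?(ltW d0).
Qed.

End DenseGraph.

(** * Choice of constants and conclusion *)

Theorem theorem1p5 (R : realType) (k : nat) (H : sgraph)
  (hk : (0 < k)%N) (hH : decomposable (cycle_graph (2 * k + 1)) H)
  (eta : R) (heta : 0 < eta) :
  exists rho : R, 0 < rho /\
  exists n0 : nat, forall (d : R) (G : sgraph),
    0 <= d -> locally_dense rho d G -> (n0 <= #|G|)%N ->
    d ^+ #|edges H| - eta <= hom_density R H G.
Proof.
rewrite addn1 in hH; have [X0 [l [gl isoZ cover]]] := decomposable_gluing hH.
(* [m] will be a lower bound for [d] in the nontrivial case, which lets [rho] be chosen before [d];
   [N] factors [1 - eps] will occur, and [N * eps = m] keeps their total loss at most [eta]. *)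
pose m := Num.min eta 1; pose N := (size l).+1; pose eps := m / N%:R.
have N0 : 0 < N%:R :> R by rewrite ltr0n.
have m0 : 0 < m by rewrite lt_min heta ltr01.
have m1 : m <= 1 by rewrite ge_min lexx orbT.
have eps0 : 0 < eps by rewrite divr_gt0.
have eps_m : eps <= m by rewrite ler_pdivrMr// ler_peMr ?(ltW m0)// ler1n.
have rho0 : 0 < eps * m ^+ (2 * k) by rewrite mulr_gt0 ?exprn_gt0.
exists (eps * m ^+ (2 * k)); split=> //; exists 1%N => d G d_ge0 Gdense G0.
have [x0 _] := card_gt0P G0.
have rho1 : eps * m ^+ (2 * k) <= 1.
  rewrite -[1]mulr1; apply: ler_pM; rewrite ?exprn_ge0 ?(ltW m0) ?(ltW eps0)//.
    exact: le_trans eps_m m1.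
  by rewrite exprn_ile1// ltW.
have dens0 : 0 <= hom_density R H G by rewrite divr_ge0 ?exprn_ge0.
(* If [d ^+ #|edges H|] is at most [eta] the claim is trivial. Otherwise [eta < 1], and as [H] has
   an edge, [d] is at least that power and so exceeds [eta = m]. *)
have [small|big] := leP (d ^+ #|edges H|) eta.
  by apply: le_trans dens0; rewrite subr_le0.
have d1 : d <= 1 by apply: locally_dense_le1 Gdense G0 rho1.
have eta1 : eta < 1 by apply: lt_le_trans big _; rewrite exprn_ile1.
have m_eta : m = eta by rewrite /m min_l// ltW.
have eH : (0 < #|edges H|)%N.
  have X0l : X0 \in parts X0 l by rewrite mem_rcons inE eqxx.
  have [c lab] := isomorphic_labelling (isoZ _ X0l).
  apply: leq_trans (leq_trans (leq_addr _ _) (gluing_edges gl)).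
  by rewrite (card_edges_in_whole _ lab)//; clear -hk; lia.
have m_le_d : m <= d.
  rewrite m_eta; apply: le_trans (ltW big) _.
  by rewrite -(prednK eH) exprS ler_piMr// exprn_ile1.
have d0 : 0 < d by apply: lt_le_trans m_le_d.
have rho_eps : eps * m ^+ (2 * k) <= eps * d ^+ (2 * k).
  rewrite ler_wpM2l ?(ltW eps0)//; apply: lerXn2r => //; rewrite nnegrE; exact: ltW.
have eps1 : eps < 1 by apply: le_lt_trans eps_m _; rewrite m_eta.
apply: le_trans (gluing_hom_density x0 hk rho0 rho1 d0 Gdense (ltW eps0) eps1
  rho_eps gl isoZ cover).
have eps01 : 0 <= eps <= 1 by rewrite !ltW.
(* Bernoulli's inequality bounds the accumulated factor below by [1 - m]. *)
have := onem_expr_ge N eps01.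
rewrite /eps mulrC divfK ?lt0r_neq0// -/eps => bern.
have dE0 : 0 <= d ^+ #|edges H| by rewrite exprn_ge0.
have dE1 : d ^+ #|edges H| <= 1 by rewrite exprn_ile1.
have := ler_wpM2r dE0 bern; apply: le_trans.
have : m * d ^+ #|edges H| <= m by rewrite ler_piMr// ltW.
rewrite m_eta; move: (d ^+ _) => D; clear; lra.
Qed.
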